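(* Let $M_k$ be a cohopfian right module over a ring $k$ which has the finite exchange property. Then $M$ has the countable ($\aleph_0$-)exchange property.
   Context: A module is cohopfian if every injective endomorphism of it is an automorphism. For a cardinal $\aleph$, a module $M_k$ has the $\aleph$-exchange property if whenever $A=M\oplus N=\bigoplus_{i\in I}A_i$ (internal direct sums of submodules of a module $A$) with $|I|\le\aleph$, there are submodules $A_i'\subseteq A_i$ such that $A=M\oplus\bigoplus_{i\in I}A_i'$. Finite exchange means $\aleph$-exchange for every finite cardinal $\aleph$; countable exchange means $\aleph_0$-exchange. *)

(* Defs.v *)
From HB Require Import structures.
From mathcomp Require Import all_boot all_order all_algebra.
Set Implicit Arguments. Unset Strict Implicit. Unset Printing Implicit Defensive.
Import GRing.Theory.
Local Open Scope ring_scope.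

(* Right modules over a ring k are represented as left modules over the
   converse ring k^c (i.e. lmodType k^c). *)

Section Defs.
Variable (R : nzRingType).

Definition submodule (A : lmodType R) (S : A -> Prop) : Prop :=
  [/\ S 0, (forall x y, S x -> S y -> S (x + y)) &
      (forall (r : R) x, S x -> S (r *: x))].

Definition int_dsum (A : lmodType R) (I : eqType) (S : I -> A -> Prop) : Prop :=
  [/\ forall i, submodule (S i),
      (forall a : A, exists (s : seq I) (g : I -> A),
          (forall i, S i (g i)) /\ a = \sum_(i <- s) g i) &
      (forall (s : seq I) (g : I -> A), uniq s -> (forall i, S i (g i)) ->
          \sum_(i <- s) g i = 0 -> forall i, i \in s -> g i = 0)].

Definition int_dsum2 (A : lmodType R) (P Q : A -> Prop) : Prop :=
  int_dsum (fun b : bool => if b then P else Q).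

(* Exchange property of M for decompositions indexed by I:
   whenever A = M' (+) N = (+)_{i in I} A_i with M' ~ M (given as the image
   of an injective linear map f : M -> A), there are submodules A_i' of A_i
   with A = M' (+) (+)_i A_i'. *)
Definition exchange_for (M : lmodType R) (I : eqType) : Prop :=
  forall (A : lmodType R) (f : {linear M -> A}) (N : A -> Prop)
         (Ai : I -> A -> Prop),
    injective f ->
    int_dsum2 (fun a => exists m, a = f m) N ->
    int_dsum Ai ->
    exists Ai' : I -> A -> Prop,
      (forall i, submodule (Ai' i)) /\
      (forall i a, Ai' i a -> Ai i a) /\
      int_dsum (fun o : option I =>
                  match o with
                  | None => fun a => exists m, a = f m
                  | Some i => Ai' i
                  end).

Definition finite_exchange (M : lmodType R) : Prop :=
  forall I : finType, exchange_for M I.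

Definition countable_exchange (M : lmodType R) : Prop :=
  forall I : countType, exchange_for M I.

Definition cohopfian (M : lmodType R) : Prop :=
  forall f : {linear M -> M}, injective f -> bijective f.

End Defs.

(* Main.v *)
(* Let A = M + N be the direct sum of the A_i. The components x_i : M -> A_i -> M
   form a pointwise finite family of endomorphisms with sum 1. Finite exchange,
   applied successively to t_n = x_n + t_(n+1), where t_n = 1 - (x_0 + ... + x_(n-1)),
   gives idempotents e_n = c_n x_n with e_i e_j = 0 for i < j, such that M is the
   sum of the images of e_0, ..., e_(n-1) and of an idempotent in End(M) t_n.
   An m killed by all e_i is killed by some t_n, hence zero; so the pointwise
   finite sum of the e_i is injective, and therefore bijective as M is cohopfian.
   The complement of M is the sum of the kernels in A_i of a |-> e_i c_i pi(a),
   with pi : A -> M the projection along N. *)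
Require Import Defs.
From HB Require Import structures.
From mathcomp Require Import all_boot all_order all_algebra.
From mathcomp Require Import boolp.
Set Implicit Arguments. Unset Strict Implicit. Unset Printing Implicit Defensive.
Import GRing.Theory.
Local Open Scope ring_scope.

Lemma eq_big_support (V : nmodType) (I : eqType) (s s' : seq I) (g : I -> V) :
  uniq s -> uniq s' -> {subset s <= s'} ->
  (forall i, i \in s' -> i \notin s -> g i = 0) ->
  \sum_(i <- s) g i = \sum_(i <- s') g i.
Proof.
move=> us us' sub g0.
rewrite [RHS](bigID (mem s)) /= [X in _ + X]big1_seq ?addr0; last first.
  by move=> i /andP[nis is']; apply: g0.
rewrite -[RHS]big_filter; apply: perm_big; apply: uniq_perm => //.
  exact: filter_uniq.
by move=> i; rewrite mem_filter /=; case: (boolP (i \in s)) => // /sub ->.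
Qed.

Lemma linear_pack (R : nzRingType) (U V : lmodType R) (h : U -> V) :
  linear h -> exists g : {linear U -> V}, g =1 h.
Proof.
move=> lin_h.
pose L := GRing.isLinear.Build R U V _ h lin_h.
pose g : {linear U -> V} := HB.pack h L.
by exists g.
Qed.

(** * Internal direct sums: projections, maps out of them, and complements *)

Section DirectSum.
Variables (R : nzRingType) (A : lmodType R) (I : eqType) (S : I -> A -> Prop).
Hypothesis dsumS : int_dsum S.

Lemma dsum_proj : exists p : I -> {linear A -> A},
  [/\ forall i a, S i (p i a),
      (forall a, exists2 s, uniq s & forall i, i \notin s -> p i a = 0),
      (forall s a, uniq s -> (forall i, i \notin s -> p i a = 0) ->
         a = \sum_(i <- s) p i a),
      (forall i a, S i a -> p i a = a) &
      (forall i j a, i != j -> S i a -> p j a = 0)].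
Proof.
have [subS genS freeS] := dsumS.
have S0 i : S i 0 by case: (subS i).
have SD i x y : S i x -> S i y -> S i (x + y) by case: (subS i) => _ + _; apply.
have SZ i r x : S i x -> S i (r *: x) by case: (subS i) => _ _; apply.
(* The lists given by [int_dsum] may repeat indices, and [g] is arbitrary outside them. Forcing [h]
   to vanish off a duplicate-free list makes it unique for [a]; this uniqueness is what makes the
   chosen components linear. *)
pose dec a (h : I -> A) := (forall i, S i (h i)) /\
  exists s, [/\ uniq s, forall i, i \notin s -> h i = 0 & a = \sum_(i <- s) h i].
have widen (s s' : seq I) (h : I -> A) : uniq s -> uniq s' -> {subset s <= s'} ->
    (forall i, i \notin s -> h i = 0) -> \sum_(i <- s) h i = \sum_(i <- s') h i.
  by move=> us us' sub h0; apply: eq_big_support => // i _; apply: h0.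
have dec_lin r a b h h' : dec a h -> dec b h' ->
    dec (r *: a + b) (fun i => r *: h i + h' i).
  move=> [Sh [s [us h0 ->]]] [Sh' [s' [us' h0' ->]]]; split=> [i|].
    by apply: SD => //; apply: SZ.
  exists (undup (s ++ s')); rewrite undup_uniq; split=> // [i|].
    rewrite mem_undup mem_cat negb_or => /andP[/h0 -> /h0' ->].
    by rewrite scaler0 addr0.
  rewrite big_split -scaler_sumr; congr (_ *: _ + _); apply: widen => //;
    rewrite ?undup_uniq // => i; rewrite mem_undup mem_cat => ->; rewrite ?orbT //.
have dec0 h : dec 0 h -> forall i, h i = 0.
  move=> [Sh [s [us h0 /esym sum0]]] i.
  case: (boolP (i \in s)) => [|/h0 //]; exact: freeS us Sh sum0 i.
have dec_uniq a h h' : dec a h -> dec a h' -> forall i, h i = h' i.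
  move=> da da' i; have := dec_lin (-1) a a h' h da' da.
  rewrite scaleN1r addNr => /dec0/(_ i); rewrite scaleN1r addrC => /eqP.
  by rewrite subr_eq0 => /eqP.
have dec1 i a : S i a -> dec a (fun j => if i == j then a else 0).
  move=> Sa; split=> [j|]; first by case: eqP => [<-|].
  exists [:: i]; split=> // [j|]; last by rewrite big_seq1 eqxx.
  by rewrite inE eq_sym => /negPf ->.
have dec_00 : dec 0 (fun=> 0) by split=> //; exists [::]; rewrite big_nil.
have dec_ex a : exists h, dec a h.
  have [s [g [Sg ->]]] := genS a.
  elim: s => [|i s [h dh]]; first by rewrite big_nil; exists (fun=> 0).
  rewrite big_cons -[g i]scale1r; eexists.
  by apply: dec_lin dh; apply: (dec1 i).
have [D decD] := choice dec_ex.
have linD i : linear (fun a => D a i).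
  move=> r a b; exact: dec_uniq (decD _) (dec_lin r a b _ _ (decD a) (decD b)) i.
have [p pE] := choice (fun i => linear_pack (linD i)).
exists p; split.
- by move=> i a; rewrite pE; case: (decD a).
- move=> a; have [_ [s [us h0 _]]] := decD a; exists s => // i /h0.
  by rewrite pE.
- move=> s a us p0; have [_ [s' [us' h0 e]]] := decD a.
  rewrite {1}e (@widen s' (undup (s ++ s'))) ?undup_uniq //; last first.
    by move=> i; rewrite mem_undup mem_cat => ->; rewrite orbT.
  under eq_bigr do rewrite -pE.
  apply/esym/widen; rewrite ?undup_uniq // => i.
  by rewrite mem_undup mem_cat => ->.
- move=> i a Sa; rewrite pE (dec_uniq _ _ _ (decD a) (dec1 i a Sa)).
  by rewrite eqxx.
- move=> i j a ij Sa; rewrite pE (dec_uniq _ _ _ (decD a) (dec1 i a Sa)).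
  by rewrite (negPf ij).
Qed.

Lemma dsum_retract (M : lmodType R) (f : {linear M -> A}) i :
  injective f -> (forall a, S i a <-> exists m, a = f m) ->
  exists2 g : {linear A -> M}, (forall m, g (f m) = m) &
    forall j a, j != i -> S j a -> g a = 0.
Proof.
move=> injf Sf; have [p [Sp _ _ p_id p_0]] := dsum_proj.
have [g gE] := choice (fun a => (Sf (p i a)).1 (Sp i a)).
have ling : linear g.
  by move=> r a b; apply: injf; rewrite linearP -!gE linearP.
have [g' g'E] := linear_pack ling.
exists g' => [m|j a ji Sa]; apply: injf; rewrite g'E -gE.
  by apply: p_id; apply/Sf; exists m.
by rewrite linear0; apply: p_0 Sa.
Qed.

Lemma dsum_ext (M : lmodType R) (q : I -> {linear A -> M}) :
  exists h : {linear A -> M}, forall i a, S i a -> h a = q i a.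
Proof.
have [p [Sp pfin psum p_id p_0]] := dsum_proj.
(* The value is to be right for every list covering the support of [a], so that one common list can
   serve [a], [b] and [r *: a + b] in the proof of linearity. *)
have hex a : exists b, forall s, uniq s -> (forall i, i \notin s -> p i a = 0) ->
    b = \sum_(i <- s) q i (p i a).
  have [s us s0] := pfin a; exists (\sum_(i <- s) q i (p i a)) => s' us' s0'.
  have us2 : uniq (undup (s ++ s')) by exact: undup_uniq.
  transitivity (\sum_(i <- undup (s ++ s')) q i (p i a)); last apply/esym;
    apply: eq_big_support => // i; rewrite ?mem_undup ?mem_cat.
  - by move=> ->.
  - by move=> _ /s0 ->; rewrite linear0.
  - by move=> ->; rewrite orbT.
  - by move=> _ /s0' ->; rewrite linear0.
have [h hE] := choice hex.
have linh : linear h.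
  move=> r a b; have [s us s0] := pfin a; have [s' us' s0'] := pfin b.
  have us2 : uniq (undup (s ++ s')) by exact: undup_uniq.
  have t0 i : i \notin undup (s ++ s') -> p i a = 0 /\ p i b = 0.
    by rewrite mem_undup mem_cat negb_or => /andP[/s0 -> /s0' ->].
  rewrite !(hE _ (undup (s ++ s'))) //.
  - rewrite scaler_sumr -big_split; apply: eq_bigr => i _ /=.
    by rewrite !linearP.
  - by move=> i /t0[].
  - by move=> i /t0[].
  - by move=> i /t0[pa pb]; rewrite linearP pa pb scaler0 addr0.
have [h' h'E] := linear_pack linh.
exists h' => i a Sa; rewrite h'E (hE _ [:: i]) //.
  by rewrite big_seq1 p_id.
by move=> j; rewrite inE eq_sym => ij; apply: p_0 Sa.
Qed.

(** Bijectivity of [h \o f] splits [A] into the image of [f] and the kernel of [h]. As the images of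
    the [q i] are independent, [h] kills an element only if each [q i] kills its component, so the
    kernel of [h] is the sum of the kernels of the [q i] in [S i]. *)
Lemma exchange_criterion (M : lmodType R) (f : {linear M -> A})
    (q : I -> {linear A -> M}) (h : {linear A -> M}) :
  (forall i a, S i a -> h a = q i a) -> bijective (h \o f) ->
  (forall (s : seq I) (z : I -> A), uniq s -> \sum_(i <- s) q i (z i) = 0 ->
     forall i, i \in s -> q i (z i) = 0) ->
  int_dsum (fun o => match o with
                     | None => fun a => exists m, a = f m
                     | Some i => fun a => S i a /\ q i a = 0
                     end).
Proof.
move=> hq [w fK wK] indep; have [subS genS freeS] := dsumS.
have [p [Sp pfin psum p_id p_0]] := dsum_proj.
split=> [[i|]|a|s g us Sg sum0].
- have [S0 SD SZ] := subS i; split.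
  + by rewrite linear0.
  + by move=> x y [Sx qx] [Sy qy]; rewrite linearD qx qy addr0; split=> //; apply: SD.
  + by move=> r x [Sx qx]; rewrite linearZ /= qx scaler0; split=> //; apply: SZ.
- split; first by exists 0; rewrite linear0.
  + by move=> _ _ [x ->] [y ->]; exists (x + y); rewrite linearD.
  + by move=> r _ [x ->]; exists (r *: x); rewrite linearZ.
- pose m := w (h a); pose b := a - f m.
  have hb : h b = 0 by rewrite linearB; have /= -> := wK (h a); rewrite subrr.
  have [s us s0] := pfin b; have bE := psum _ _ us s0.
  exists (None :: [seq Some i | i <- s]).
  exists (fun o => if o is Some i then p i b else f m); split=> [[i|]|].
  + split=> //; case: (boolP (i \in s)) => [|/s0 ->]; last by rewrite linear0.
    move=> si; apply: (indep s (fun i => p i b)) => //.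
    apply: etrans hb; rewrite [X in h X]bE linear_sum; apply: eq_bigr => j _.
    by rewrite (hq j).
  + by exists m.
  + by rewrite big_cons big_map -bE /b addrC subrK.
- have hg i : h (g (Some i)) = 0 by have [Si qi] := Sg (Some i); rewrite (hq i).
  have gN : None \in s -> g None = 0.
    move=> Ns; have [m gm] := Sg None.
    move: (congr1 h sum0); rewrite linear0 linear_sum (bigD1_seq None) //=.
    rewrite big1 ?addr0; last by case.
    have w0 : w 0 = 0 by have := fK 0; rewrite /= !linear0.
    by rewrite gm => hm; rewrite -[m]fK /= hm w0 linear0.
  have us' : uniq (pmap id s).
    by apply: (@pmap_uniq _ _ id Some) => //; case.
  have gs : \sum_(i <- pmap id s) g (Some i) = 0.
    rewrite -[RHS]sum0; elim: (s) gN {us us' sum0} => [|[i|] s' IH] gN /=.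
    - by rewrite !big_nil.
    - by rewrite !big_cons IH // => N; apply: gN; rewrite inE N orbT.
    - by rewrite big_cons gN ?inE // add0r; apply: IH => N; apply: gN; rewrite inE N orbT.
  case=> [i|//] si; apply: (freeS _ (fun i => g (Some i)) us') => //.
    by move=> j; case: (Sg (Some j)).
  by rewrite mem_pmap map_id.
Qed.

End DirectSum.

(** * Idempotent endomorphisms obtained from exchange *)

Section Exchange.
Variables (R : nzRingType) (M : lmodType R).

(* Exchange for the copy {(x m, y m)} of M in M * M, whose complement is the
   antidiagonal. *)
Lemma exchange_pair (x y : {linear M -> M}) :
  exchange_for M bool -> (forall m, x m + y m = m) ->
  exists a b : {linear M -> M},
    (forall m, a (x m) + b (y m) = m) /\ (forall m, b (y (b m)) = b m).
Proof.
move=> hex xy1; pose A : lmodType R := (M * M)%type.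
have linf : linear (fun m => (x m, y m) : A).
  by move=> r m m'; rewrite !linearP.
have [f fE] := linear_pack linf.
pose N (u : A) := u.1 + u.2 = 0.
pose Ai (b : bool) (u : A) := if b then u.2 = 0 else u.1 = 0.
have injf : injective f.
  by move=> m m'; rewrite !fE => -[ex ey]; rewrite -[m]xy1 -[m']xy1 ex ey.
have dsum2 (P Q : A -> Prop) : submodule P -> submodule Q ->
    (forall u, exists2 v, P v & Q (u - v)) ->
    (forall u, P u -> Q (- u) -> u = 0) -> int_dsum2 P Q.
  move=> sP sQ gen free; split=> [[]//|u|s g us Sg].
    have [v Pv Qv] := gen u; exists [:: true; false].
    exists (fun b => if b then v else u - v); split; first by case.
    by rewrite big_cons big_seq1 addrC subrK.
  have [[P0 _ _] [Q0 _ _]] := (sP, sQ).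
  pose g' b := if b \in s then g b else 0.
  have -> : \sum_(i <- s) g i = g' true + g' false.
    transitivity (\sum_(i <- s) g' i).
      by apply: eq_big_seq => i si; rewrite /g' si.
    transitivity (\sum_(i <- [:: true; false]) g' i).
      by apply: eq_big_support => // [[]|i _ /negPf ni]; rewrite ?inE // /g' ni.
    by rewrite big_cons big_seq1.
  move=> /eqP; rewrite addr_eq0 => /eqP gE.
  have Pt : P (g' true) by rewrite /g'; case: ifP => // _; apply: (Sg true).
  have Qf : Q (g' false) by rewrite /g'; case: ifP => // _; apply: (Sg false).
  have gt0 : g' true = 0 by apply: free => //; rewrite gE opprK.
  have gf0 : g' false = 0 by apply/eqP; rewrite -oppr_eq0 -gE gt0.
  by case=> si; rewrite /g' si in gt0 gf0.
have dsumMN : int_dsum2 (fun u => exists m, u = f m) N.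
  apply: dsum2 => [|||_ [m ->]].
  - split; first by exists 0; rewrite linear0.
    + by move=> _ _ [m ->] [m' ->]; exists (m + m'); rewrite linearD.
    + by move=> r _ [m ->]; exists (r *: m); rewrite linearZ.
  - rewrite /N; split=> [|u v Nu Nv|r u Nu] /=; first exact: addr0.
    + by rewrite addrACA Nu Nv addr0.
    + by rewrite -scalerDr Nu scaler0.
  - move=> u; exists (f (u.1 + u.2)); first by exists (u.1 + u.2).
    by rewrite /N fE /= addrACA -opprD xy1 subrr.
  - rewrite fE /N /= -opprD xy1 => /eqP; rewrite oppr_eq0 => /eqP ->.
    by rewrite !linear0.
have dsumA : int_dsum Ai.
  have -> : Ai = fun b => if b then Ai true else Ai false.
    by apply/funext => -[].
  apply: dsum2; rewrite /Ai /=.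
  - split=> [//|u v /= -> ->|r u /= ->]; [exact: addr0 | exact: scaler0].
  - split=> [//|u v /= -> ->|r u /= ->]; [exact: addr0 | exact: scaler0].
  - by move=> [m m']; exists (m, 0) => //=; rewrite subrr.
  - move=> [m m'] /= -> /eqP; rewrite oppr_eq0 => /eqP -> //.
have [A' [subA' [A'A dsumA']]] := hex A f N Ai injf dsumMN dsumA.
(* [g] is the projection onto the copy of [M] along the new complement; [a] and [b] will be its
   restrictions to the two factors. *)
have [g gf gA'] := dsum_retract dsumA' injf (i := None) (fun=> iff_refl _).
have {}gA' b u : A' b u -> g u = 0 by apply: (gA' (Some b)).
have lini1 : linear (fun m => (m, 0) : A).
  by move=> r m m'; congr (_, _); rewrite /= scaler0 addr0.
have lini2 : linear (fun m => (0, m) : A).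
  by move=> r m m'; congr (_, _); rewrite /= scaler0 addr0.
have [i1 i1E] := linear_pack lini1; have [i2 i2E] := linear_pack lini2.
(* The kernel of [g] is the sum of [A' true], inside [M * 0], and [A' false], inside [0 * M]. Hence
   [(0, m')] is the [A' false] component of [(m, m')]. *)
have g0 m m' : g (m, m') = 0 -> g (0, m') = 0.
  move=> gm; have [p [Sp _ psum _ _]] := dsum_proj dsumA'.
  have us : uniq [:: None; Some true; Some false] by [].
  have e : (m, m') = \sum_(o <- [:: None; Some true; Some false]) p o (m, m').
    by apply: psum => // -[[]|].
  rewrite !big_cons big_nil addr0 in e.
  have [n pN] := Sp None (m, m').
  have A't := Sp (Some true) (m, m'); have A'f := Sp (Some false) (m, m').
  have n0 : n = 0.
    by move: gm; rewrite e !linearD pN gf (gA' _ _ A't) (gA' _ _ A'f) !addr0.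
  rewrite pN n0 linear0 add0r in e.
  have /= t2 := A'A _ _ A't; have /= f1 := A'A _ _ A'f.
  rewrite (_ : (0, m') = p (Some false) (m, m')) ?(gA' _ _ A'f) //.
  move: (congr1 snd e) => /=; rewrite t2 add0r => m'E.
  by rewrite [RHS]surjective_pairing f1 -m'E.
exists (g \o i1), (g \o i2); split=> [m|m] /=.
  rewrite i1E i2E -linearD -[RHS]gf fE; congr (g (_, _)); rewrite /= ?addr0 //.
  exact: add0r.
pose z := y (g (i2 m)).
have : g (x (g (i2 m)), z - m) = 0.
  have -> : (x (g (i2 m)), z - m) = f (g (i2 m)) - i2 m.
    by rewrite /z fE i2E; congr (_, _); apply/esym/subr0.
  by rewrite linearB gf subrr.
move/g0; rewrite -i2E !linearB => /eqP; rewrite subr_eq0 => /eqP //.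
Qed.

(* With [F = r t], this is exchange in the corner ring [F End(M) F] for the
   decomposition [F = F r x F + F r t' F]; the coefficients are then moved so that
   the new idempotents [c x] and [r' t'] end in [x] and [t'] rather than in [F],
   at the price of orthogonality on one side. *)
Lemma exchange_step (r t x t' : {linear M -> M}) :
  exchange_for M bool ->
  (forall m, t m = x m + t' m) -> (forall m, r (t (r (t m))) = r (t m)) ->
  exists c r' : {linear M -> M},
  [/\ forall m, r (t (c (x m))) = c (x m), forall m, r (t (r' (t' m))) = r' (t' m),
      (forall m, c (x (c (x m))) = c (x m)) /\
      (forall m, r' (t' (r' (t' m))) = r' (t' m)),
      forall m, c (x (r' (t' m))) = 0 &
      forall m, c (x (r (t m))) + r' (t' (r (t m))) = r (t m)].
Proof.
move=> hex tE FF'.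
have [F FE] : exists F : {linear M -> M}, forall m, F m = r (t m) by exists (r \o t).
have FF m : F (F m) = F m by rewrite !FE.
(* Adding [idfun \- F] turns the unit [F] of the corner into the identity of [M], as [exchange_pair]
   demands; the addition vanishes on the image of [F]. *)
pose X : {linear M -> M} := (F \o r \o x \o F) \+ (idfun \- F).
pose Y : {linear M -> M} := F \o r \o t' \o F.
have XE m : X m = F (r (x (F m))) + (m - F m) by [].
have YE m : Y m = F (r (t' (F m))) by [].
have XY m : X m + Y m = m.
  by rewrite XE YE addrAC -!linearD /= -tE -FE !FF addrC subrK.
have [a [b [ab bYb]]] := exchange_pair hex XY.
have [C CE] : exists C : {linear M -> M}, forall m, C m = F (a (F (r m))).
  by exists (F \o a \o F \o r).
have [D DE] : exists D : {linear M -> M}, forall m, D m = F (b (F (r m))).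
  by exists (F \o b \o F \o r).
have [e eE] : exists e : {linear M -> M}, forall m, e m = C (x (F m)).
  by exists (C \o x \o F).
have [f fE] : exists f : {linear M -> M}, forall m, f m = D (t' (F m)).
  by exists (D \o t' \o F).
have fY m : f m = F (b (Y m)) by rewrite fE DE YE.
have Fe m : F (e m) = e m by rewrite eE CE FF.
have Ff m : F (f m) = f m by rewrite fY FF.
have fF m : f (F m) = f m by rewrite !fE FF.
have ff m : f (f m) = f m by rewrite [f m]fY fF !fY bYb.
have efF m : e m + f m = F m.
  rewrite -[in RHS](FF m) -[in RHS](ab (F m)) linearD XE !FF subrr addr0.
  by rewrite eE CE fY !YE FF.
have eB m : e m = F m - f m by rewrite -efF addrK.
have ee m : e (e m) = e m by rewrite [e (e m)]eB Fe {2}eB linearB /= fF ff subrr subr0.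
have ef m : e (f m) = 0 by rewrite eB Ff ff subrr.
(* Since [e = F e], one has [C x e = C x F e = e e = e], so with [e] in front [e C x] is idempotent
   without a trailing [F]. The same goes for [f D t']. *)
exists (e \o C), (f \o D) => /=; split.
- by move=> m; rewrite -FE Fe.
- by move=> m; rewrite -FE Ff.
- split=> m; first by rewrite -[X in x X]Fe -eE !ee.
  by rewrite -[X in t' X]Ff -fE !ff.
- by move=> m; rewrite -[f _]Ff -eE ef linear0.
- by move=> m; rewrite -!FE -eE -fE ee ff efF.
Qed.

(** Strong induction on [k i]: applying [e i] to the sum kills the terms of larger rank by one-sided
    orthogonality, those of smaller rank are already zero, and [e i (z i)] remains. *)
Lemma triangular_indep (J : eqType) (k : J -> nat) (e : J -> {linear M -> M}) :
  injective k -> (forall i m, e i (e i m) = e i m) ->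
  (forall i j m, (k i < k j)%N -> e i (e j m) = 0) ->
  forall (s : seq J) (z : J -> M), uniq s ->
    (forall i, i \in s -> e i (\sum_(j <- s) e j (z j)) = 0) ->
    forall i, i \in s -> e i (z i) = 0.
Proof.
move=> injk ee tri s z us e0 i; have [n] := ubnP (k i).
elim: n i => // n IH i lekin si; have := e0 i si.
rewrite linear_sum (bigD1_seq i) //= big1_seq ?addr0 ?ee // => j /andP[ji sj].
have [kij|kji|/injk kij] := ltngtP (k i) (k j); first exact: tri.
- by rewrite IH ?linear0 //; apply: leq_trans kji _.
- by rewrite kij eqxx in ji.
Qed.

Lemma exchange_sequence (x t : nat -> {linear M -> M}) :
  exchange_for M bool -> (forall m, t 0 m = m) ->
  (forall n m, t n m = x n m + t n.+1 m) ->
  exists c : nat -> {linear M -> M},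
  [/\ forall n m, c n (x n (c n (x n m))) = c n (x n m),
      forall i j m, (i < j)%N -> c i (x i (c j (x j m))) = 0 &
      forall n m, t n m = 0 -> (forall i, (i < n)%N -> c i (x i m) = 0) -> m = 0].
Proof.
move=> hex t0 tS; pose T : Type := {linear M -> M}.
pose good n (r : T) := forall m, r (t n (r (t n m))) = r (t n m).
(* The invariant [good] is a premise inside the existential, with a dummy pair where it fails, so
   that choice gives a total step function to iterate. *)
have step (nr : nat * T) : exists cr : T * T, good nr.1 nr.2 ->
    let: (n, r) := nr in let: (c, r') := cr in
    [/\ forall m, r (t n (c (x n m))) = c (x n m),
        forall m, r (t n (r' (t n.+1 m))) = r' (t n.+1 m),
        (forall m, c (x n (c (x n m))) = c (x n m)) /\ good n.+1 r',
        forall m, c (x n (r' (t n.+1 m))) = 0 &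
        forall m, c (x n (r (t n m))) + r' (t n.+1 (r (t n m))) = r (t n m)].
  case: nr => n r; case: (EM (good n r)) => [gr|ngr]; last by exists (r, r).
  by have [c [r' H]] := exchange_step hex (tS n) gr; exists (c, r').
have [st stP] := choice step.
pose r := fix r n : T := if n is n'.+1 then (st (n', r n')).2 else idfun.
pose c n := (st (n, r n)).1.
have {stP} stP n : good n (r n) -> _ := stP (n, r n).
have gr n : good n (r n).
  elim: n => [m|n /stP]; first by rewrite /= !t0.
  by rewrite /=; case: (st _) => c' r' [_ _ []].
pose e n : T := c n \o x n; pose F n : T := r n \o t n.
have {}stP n : [/\ forall m, F n (e n m) = e n m,
                  forall m, F n (F n.+1 m) = F n.+1 m,
                  forall m, e n (e n m) = e n m,
                  forall m, e n (F n.+1 m) = 0 &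
                  forall m, e n (F n m) + F n.+1 (F n m) = F n m].
  have := stP n (gr n); rewrite /F /e /c /=.
  by case: (st _) => c' r' [? ? [? ?] ? ?].
have FF n m : F n (F n m) = F n m by exact: gr.
have F0 m : F 0 m = m by rewrite /F /= t0.
(* The images of the [F n] decrease. Thus [e i], which kills the image of [F i.+1], kills those of
   all later [F j] and [e j]. *)
have Fij i d m : F i (F (i + d)%N m) = F (i + d)%N m.
  elim: d m => [|d IH] m; first by rewrite addn0 FF.
  by rewrite addnS; have [_ FS _ _ _] := stP (i + d)%N; rewrite -FS IH.
have eF i j m : (i < j)%N -> e i (F j m) = 0.
  by move=> /subnKC <-; rewrite -Fij; case: (stP i) => _ _ _ ->.
have ee i m : e i (e i m) = e i m by case: (stP i).
have tri i j m : (i < j)%N -> e i (e j m) = 0.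
  by move=> ij; case: (stP j) => <- *; rewrite eF.
have span n m : exists (z : nat -> M) w, m = \sum_(i <- iota 0 n) e i (z i) + F n w.
  elim: n => [|n [z [w ->]]].
    by exists (fun=> 0), m; rewrite big_nil add0r F0.
  (* [F n w] is both the new coefficient and the new remainder, because
     [e n F n + F n.+1 F n = F n]. *)
  exists (fun i => if i == n then F n w else z i), (F n w).
  rewrite -addn1 iotaD big_cat /= big_seq1 add0n eqxx -addrA addn1.
  have [_ _ _ _ ->] := stP n; congr (_ + _).
  apply: eq_big_seq => i; rewrite mem_iota add0n => /andP[_ lin].
  by rewrite (ltn_eqF lin).
exists c; split=> // n m tm em; have [z [w mE]] := span n m.
have z0 : forall i, i \in iota 0 n -> e i (z i) = 0.
  apply: (triangular_indep (k := id)) => // [|i]; first exact: iota_uniq.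
  rewrite mem_iota add0n => /andP[_ lin].
  by rewrite -[X in e i X](addrK (F n w)) -mE linearB (eF _ _ _ lin) subr0; apply: em.
have mF : m = F n w by rewrite mE big1_seq ?add0r // => i /andP[_ /z0].
by rewrite mF -FF -mF /F /= tm linear0.
Qed.

(** * Countable exchange for cohopfian modules *)

Lemma cohopfian_countable_exchange :
  cohopfian M -> exchange_for M bool -> countable_exchange M.
Proof.
move=> coh hex I A f N S injf dsumMN dsumS.
have [pi pif _] := dsum_retract dsumMN injf (i := true) (fun=> iff_refl _).
have [p [Sp pfin psum p_id p_0]] := dsum_proj dsumS.
(* [pickle_inv] is defined only at exact codes, so each index contributes once; numbers coding no
   index get the zero map. *)
pose x n : {linear M -> M} :=
  if @pickle_inv I n is Some i then pi \o p i \o f else \0.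
pose t := fix t n : {linear M -> M} := if n is n'.+1 then t n' \- x n' else idfun.
have xE i m : x (pickle i) m = pi (p i (f m)) by rewrite /x pickleK_inv.
have tE n m : t n m = m - \sum_(i <- iota 0 n) x i m.
  elim: n => [|n IH]; first by rewrite big_nil subr0.
  by rewrite -addn1 iotaD big_cat big_seq1 opprD addrA -IH addn1.
have tfin m : exists n, t n m = 0.
  (* The successor is there because [t n] subtracts only the [x i] with [i < n], and the largest
     code must be included. *)
  have [s us s0] := pfin (f m); pose n := (\max_(i <- s) pickle i).+1.
  exists n; rewrite tE; apply/eqP; rewrite subr_eq0; apply/eqP.
  rewrite -[LHS]pif (psum _ _ us s0) linear_sum.
  under eq_bigr do rewrite /= -xE.
  rewrite -(big_map (@pickle I) xpredT (fun n => x n m)).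
  apply: eq_big_support; rewrite ?iota_uniq //.
  - by rewrite map_inj_uniq //; apply: pcan_inj pickleK_inv.
  - by move=> _ /mapP[i si ->]; rewrite mem_iota /= ltnS leq_bigmax_seq.
  - move=> j _ nj; case E: (@pickle_inv I j) => [i|]; last by rewrite /x E.
    have ij : pickle i = j by have := @pickle_invK I j; rewrite E.
    rewrite -ij xE s0 ?linear0 //; apply: contra nj => si.
    by rewrite -ij map_f.
have [c [ee tri tinj]] := exchange_sequence hex (fun=> erefl) (t := t) (x := x)
  (fun n m => etrans (esym (subrK (x n m) (t n m))) (addrC _ _)).
pose e n : {linear M -> M} := c n \o x n.
(* The leading [e] puts all values of [q i] on [A] into the image of an idempotent, where triangular
   independence applies; by idempotence [q i \o f] is still [e (pickle i)]. *)
pose q i : {linear A -> M} := e (pickle i) \o c (pickle i) \o pi \o p i.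
have qE i a : q i a = e (pickle i) (c (pickle i) (pi (p i a))) by [].
have qf i m : q i (f m) = e (pickle i) m by rewrite qE -xE; apply: ee.
have indep := triangular_indep (pcan_inj (@pickleK_inv I))
  (e := fun i => e (pickle i)) (fun i => ee _) (fun i j m => tri _ _ m).
have qindep (s : seq I) (z : I -> A) : uniq s ->
    \sum_(i <- s) q i (z i) = 0 -> forall i, i \in s -> q i (z i) = 0.
  move=> us sum0; apply: (indep s) => // i _.
  by rewrite [X in e _ X]sum0 linear0.
have [h hq] := dsum_ext dsumS q.
exists (fun i a => S i a /\ q i a = 0).
have dsum' : int_dsum (fun o => match o with
   | None => fun a => exists m, a = f m
   | Some i => fun a => S i a /\ q i a = 0 end).
  (* Cohopficity reduces bijectivity of [h \o f] to injectivity. If [h (f m) = 0], independence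
     makes each [e j m] zero, and some [t n] kills [m], so [tinj] gives [m = 0]. *)
  apply: (exchange_criterion dsumS hq) => //; apply: coh => m1 m2.
  move=> /eqP; rewrite -subr_eq0 -linearB /=; set m := m1 - m2 => /eqP hm.
  apply/eqP; rewrite -subr_eq0 -/m; apply/eqP.
  have [n tm] := tfin m; apply: (tinj n) => // j _.
  case E: (@pickle_inv I j) => [i|]; last by rewrite /x E linear0.
  have <- : pickle i = j by have := @pickle_invK I j; rewrite E.
  have [s us s0] := pfin (f m).
  case: (boolP (i \in s)) => [si|/s0 pi0]; last by rewrite xE pi0 !linear0.
  rewrite -[LHS]qf; have qp k a : q k (p k a) = q k a by rewrite !qE (p_id k).
  rewrite -qp; apply: (qindep s (fun k => p k (f m))) => //.
  rewrite -[RHS]hm [X in h X](psum _ _ us s0) linear_sum.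
  by apply: eq_bigr => k _; rewrite (hq k).
split; last by split=> // i a [].
by move=> i; case: dsum' => /(_ (Some i)).
Qed.

End Exchange.

Theorem theorem5 (k : nzRingType) (M : lmodType k^c) :
  cohopfian M -> finite_exchange M -> countable_exchange M.
Proof. by move=> coh /(_ bool); apply: cohopfian_countable_exchange. Qed.
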